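(* Let $G$ be a locally finite weakly connected digraph, let $r \in V(G) \cup \Omega(G)$ and let $k \in \mathbb{N}$. Then $G$ has $k$ edge-disjoint spanning pseudo-arborescences rooted in $r$ if and only if every bipartition $(X,Y)$ of $V(G)$ with $r \in \overline{X}$ and $|E(X,Y)| < \infty$ satisfies $d^-(Y) \geq k$.
   Context: Digraphs may be infinite and may have parallel edges but no loops. A digraph is weakly connected if its underlying undirected multigraph is connected, and locally finite if that multigraph is locally finite (all degrees finite). The two classes of a bipartition are non-empty. A ray is a one-way infinite undirected path. Two rays in a multigraph are equivalent if they cannot be separated by finitely many vertices; the equivalence classes are the ends. The ends of a digraph $G$ are the ends of its underlying multigraph, and $\Omega(G)$ is the set of ends. For $X \subseteq V(G)$, the combinatorial closure $\overline{X} \subseteq V(G)\cup\Omega(G)$ is $X$ together with all ends containing a ray that cannot be separated from $X$ by finitely many vertices (in the underlying multigraph). For disjoint $X,Y\subseteq V(G)$: $\overrightarrow{E}(X,Y)$ is the set of edges with tail in $X$ and head in $Y$, and $E(X,Y)=\overrightarrow{E}(X,Y)\cup\overrightarrow{E}(Y,X)$. $E(X,Y)$ is a cut if $(X,Y)$ is a bipartition of $V(G)$. $d^-(Y) = |\overrightarrow{E}(V(G)\setminus Y, Y)|$. For $r \in V(G)\cup\Omega(G)$, an edge set $F\subseteq E(G)$ is a spanning $r$-reachable set if $|F\cap\overrightarrow{E}(X,Y)|\ge 1$ for every finite cut $E(X,Y)$ of $G$ with $r\in\overline{X}$ and $Y\cap (V(G)\setminus\{r\})\neq\emptyset$. A spanning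 pseudo-arborescence rooted in $r$ is an inclusion-wise minimal spanning $r$-reachable set. *)

(* Defs.v *)
From Stdlib Require Import Relation_Operators.
From mathcomp Require Import all_boot.
From mathcomp Require Import boolp classical_sets functions cardinality.

Set Implicit Arguments.
Unset Strict Implicit.
Unset Printing Implicit Defensive.

Local Open Scope classical_set_scope.

(* Possibly infinite; parallel edges are distinct elements of [edge]. *)
Record digraph := Digraph {
  vertex : Type;
  edge : Type;
  tail : edge -> vertex;
  head : edge -> vertex;
  loopless : forall e, tail e <> head e }.

Section Digraph.
Variable G : digraph.

Implicit Types (S X Y : set (vertex G)) (F : set (edge G)).

Definition joins (e : edge G) (u v : vertex G) : Prop :=
  (tail e = u /\ head e = v) \/ (tail e = v /\ head e = u).

(* As there are no loops, the degree of [v] in the underlying multigraph is the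
   number of edges incident with [v]. *)
Definition locally_finite : Prop :=
  forall v : vertex G, finite_set [set e : edge G | tail e = v \/ head e = v].

(* [u] and [v] are vertices of the same component of the underlying multigraph
   minus [S]. *)
Definition connected_off S (u v : vertex G) : Prop :=
  [/\ ~ S u, ~ S v &
    clos_refl_trans (vertex G)
      (fun x y => [/\ ~ S x, ~ S y & exists e, joins e x y]) u v].

Definition weakly_connected : Prop :=
  forall u v : vertex G, connected_off set0 u v.

(* [S] may meet [X] and [Y]; in particular [X] separates itself from any [Y]. *)
Definition separates S X Y : Prop :=
  forall x y, X x -> Y y -> ~ connected_off S x y.

Definition finitely_separable X Y : Prop :=
  exists2 S, finite_set S & separates S X Y.

Record ray := Ray {
  ray_vertex : nat -> vertex G;
  ray_edge : nat -> edge G;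
  ray_vertex_inj : injective ray_vertex;
  ray_joins : forall n, joins (ray_edge n) (ray_vertex n) (ray_vertex n.+1) }.

Definition ray_equiv (R R' : ray) : Prop :=
  ~ finitely_separable (range (ray_vertex R)) (range (ray_vertex R')).

Record graph_end := GraphEnd {
  end_rays : set ray;
  end_is_class : exists R, end_rays = [set R' | ray_equiv R R'] }.

Definition comb_closure X : set (vertex G + graph_end) :=
  [set r | match r with
           | inl v => X v
           | inr w => exists2 R, end_rays w R &
                        ~ finitely_separable (range (ray_vertex R)) X
           end].

Definition diedges X Y : set (edge G) := [set e | X (tail e) /\ Y (head e)].

Definition edges_between X Y : set (edge G) := diedges X Y `|` diedges Y X.

Definition bipartition X Y : Prop :=
  [/\ X !=set0, Y !=set0, X `&` Y = set0 & X `|` Y = setT].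

(* d^-(Y) is the cardinality of this set. *)
Definition in_edges Y : set (edge G) := diedges (~` Y) Y.

Definition spanning_reachable (r : vertex G + graph_end) F : Prop :=
  forall X Y, bipartition X Y -> finite_set (edges_between X Y) ->
    comb_closure X r -> Y `&` [set v | inl v <> r] !=set0 ->
    F `&` diedges X Y !=set0.

Definition spanning_pseudo_arborescence (r : vertex G + graph_end) F : Prop :=
  spanning_reachable r F /\
  forall F', F' `<=` F -> spanning_reachable r F' -> F' = F.

End Digraph.

(* Main.v *)
(** A finite cut does not tell a root [r] from any sequence of vertices converging
    to [r] (constant, or along a ray of the end [r]), so contracting the atoms of
    finitely many finite cuts gives a finite rooted multigraph whose cuts are
    again cuts of [G] with [r] on the tail side.  Edmonds' disjoint branching
    theorem, by Lovász's argument, then packs [k] edge sets that meet all these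
    cuts.  As every finite cut is decided by finitely many edges, an ultrafilter
    limit over all finite families of cuts gives [k] disjoint spanning reachable
    sets; for the same reason reachability passes to intersections of chains, and
    Zorn's lemma yields minimal ones. *)

From mathcomp Require Import all_boot.

Set Implicit Arguments.
Unset Strict Implicit.
Unset Printing Implicit Defensive.

(** * Edmonds' disjoint branchings in a finite multigraph *)

Section Branching.
Variables (V E : finType) (t h : E -> V) (s : V).
Implicit Types (A B : {set E}) (Y Z T : {set V}).

Definition entering A Y : {set E} := [set e in A | t e \notin Y & h e \in Y].

(** The inequality holds already for the contribution of each single edge. *)
Lemma entering_submod A Y Z :
  #|entering A (Y :&: Z)| + #|entering A (Y :|: Z)| <=
    #|entering A Y| + #|entering A Z|.
Proof.
rewrite -!sum1_card !(big_mkcond (fun e => e \in _)) -!big_split /=.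
apply: leq_sum => e _; rewrite !inE.
by case: (e \in A); case: (t e \in Y); case: (h e \in Y);
  case: (t e \in Z); case: (h e \in Z).
Qed.

(* Lovász's argument: an edge that leaves [T] inside a minimal set not contained in
   [T] and entered by only [k] edges outside [A] enters no other set entered by only
   [k] such edges, as by submodularity the intersection would be smaller. *)
Lemma branching_step k B T A :
    (forall Y, Y != set0 -> s \notin Y -> k < #|entering B Y|) ->
    s \in T -> T != setT ->
    (forall e, e \in A -> (t e \in T) && (h e \in T)) ->
    (forall Y, Y != set0 -> s \notin Y -> k <= #|entering (B :\: A) Y|) ->
  exists e, [/\ e \in B :\: A, t e \in T, h e \notin T &
    forall Y, Y != set0 -> s \notin Y -> k <= #|entering (B :\: (e |: A)) Y|].
Proof.
move=> dB sT TnT AT dBA.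
have entD Y : entering (B :\: A) (Y :\: T) = entering B (Y :\: T).
  apply/setP => e; rewrite !inE; case: (boolP (e \in A)) => //= eA.
  by have /andP[_ ->] := AT _ eA; rewrite !andbF.
(* Deleting [e] lowers a degree by at most one, so only sets of degree exactly [k] that [e] enters
   are in danger. *)
have rmv e Y : k <= #|entering (B :\: A) Y| ->
    (#|entering (B :\: A) Y| = k -> ~ (t e \notin Y /\ h e \in Y)) ->
    k <= #|entering (B :\: (e |: A)) Y|.
  move=> kd ntight.
  have -> : entering (B :\: (e |: A)) Y = entering (B :\: A) Y :\ e.
    by apply/setP => f; rewrite !inE negb_or -!andbA.
  have := cardsD1 e (entering (B :\: A) Y).
  case: (boolP (e \in entering (B :\: A) Y)) => [eY E1|_ E1]; last first.
    by move: kd; rewrite E1 add0n.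
  have [E2|] := eqVneq #|entering (B :\: A) Y| k.
    by case: (ntight E2); move: eY; rewrite !inE => /andP[_ /andP].
  move: kd; rewrite leq_eqVlt eq_sym => /orP[->//|kd _].
  by move: kd; rewrite E1 add1n ltnS.
pose tight Y := [&& s \notin Y, ~~ (Y \subset T) & #|entering (B :\: A) Y| == k].
case: (pickP tight) => [Y0 Y0t|notight].
- case: (arg_minnP (fun Y : {set V} => #|Y|) Y0t) => Y /and3P[sY YT /eqP dY] Ymin.
  have YD0 : Y :\: T != set0 by rewrite setD_eq0.
  have : #|entering (B :\: A) Y| < #|entering (B :\: A) (Y :\: T)|.
    by rewrite entD dY; apply: dB => //; rewrite !inE sT.
  move=> lt.
  (* By the larger degree some edge enters [Y :\: T] without entering [Y]; its tail then lies in
     both [Y] and [T]. *)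
  have : ~~ (entering (B :\: A) (Y :\: T) \subset entering (B :\: A) Y).
    by apply: contraL lt => /subset_leq_card; rewrite -leqNgt.
  case/subsetPn => e; rewrite !inE => /and3P[/andP[eA eB] teYT /andP[heT heY]].
  rewrite eA eB heY /= andbT negbK => teY.
  have teT : t e \in T by move: teYT; rewrite teY andbT negbK.
  exists e; split => //; first by rewrite !inE eA.
  move=> Z Z0 sZ; apply: rmv; first exact: dBA.
  move=> dZ [teZ heZ].
  have YZ0 : Y :&: Z != set0 by apply/set0Pn; exists (h e); rewrite inE heY.
  have sU : s \notin Y :|: Z by rewrite inE negb_or sY.
  have U0 : Y :|: Z != set0 by apply/set0Pn; exists (h e); rewrite inE heY.
  have sI : s \notin Y :&: Z by rewrite inE negb_and sY.
  have := entering_submod (B :\: A) Y Z; rewrite dY dZ => sub.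
  have kU := dBA _ U0 sU; have kI := dBA _ YZ0 sI.
  have tI : tight (Y :&: Z).
    rewrite /tight sI eqn_leq kI andbT /=; apply/andP; split.
      by apply/subsetPn; exists (h e) => //; rewrite inE heY.
    rewrite -(leq_add2r k); apply: leq_trans sub.
    by rewrite leq_add2l.
  have := Ymin _ tI; rewrite leqNgt => /negP; apply; apply: proper_card.
  rewrite properE subsetIl; apply/subsetPn; exists (t e) => //.
  by rewrite inE negb_and teZ orbT.
(* Without tight sets any edge leaving [T] will do: a set it enters contains its head, hence is not
   inside [T]. *)
- have CT0 : ~: T != set0 by rewrite -setTD setD_eq0 subTset.
  have : 0 < #|entering (B :\: A) (~: T)|.
    rewrite -setTD entD; apply: leq_ltn_trans (dB _ _ _) => //.
      by rewrite setTD.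
    by rewrite !inE sT.
  case/card_gt0P => e; rewrite !inE negbK => /and3P[/andP[eA eB] teT heT].
  exists e; split => //; first by rewrite !inE eA.
  move=> Z Z0 sZ; apply: rmv; first exact: dBA.
  move=> dZ [teZ heZ]; have := notight Z.
  by rewrite /tight sZ dZ eqxx andbT /= => /negbFE/subsetP/(_ _ heZ); apply/negP.
Qed.

(** The set [A] is grown from [s] one vertex at a time: [T] collects the vertices reached so far,
    and [A] enters every set that meets [T] and avoids [s]. *)
Lemma branching_extract k B :
    (forall Y, Y != set0 -> s \notin Y -> k < #|entering B Y|) ->
  exists2 A : {set E}, A \subset B & forall Y, Y != set0 -> s \notin Y ->
    entering A Y != set0 /\ k <= #|entering (B :\: A) Y|.
Proof.
move=> dB.
have grow n : exists (T : {set V}) (A : {set E}),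
  [/\ s \in T, (n < #|T|) || (T == setT), A \subset B,
    forall e, e \in A -> (t e \in T) && (h e \in T) &
    (forall Y, Y :&: T != set0 -> s \notin Y -> entering A Y != set0) /\
    (forall Y, Y != set0 -> s \notin Y -> k <= #|entering (B :\: A) Y|)].
  elim: n => [|n [T [A [sT nT AB AT [entA dBA]]]]].
    exists [set s], set0; split; rewrite ?cards1 ?sub0set ?inE //.
      by move=> e; rewrite in_set0.
    split=> [Y|Y Y0 sY]; last by rewrite setD0; exact/ltnW/dB.
    by case/set0Pn => x; rewrite !inE => /andP[xY /eqP xs]; rewrite -xs xY.
  have [TT|TnT] := eqVneq T setT.
    by exists T, A; split => //; rewrite TT eqxx orbT.
  have {}nT : n < #|T| by move: nT; rewrite (negPf TnT) orbF.
  have [e [eBA teT heT dBeA]] := branching_step dB sT TnT AT dBA.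
  have [_ eB] := setDP eBA.
  exists (h e |: T), (e |: A); split.
  - by rewrite inE sT orbT.
  - by rewrite cardsU1 heT add1n ltnS nT.
  - by rewrite subUset sub1set AB; move: eBA; rewrite inE => /andP[_ ->].
  - move=> f; rewrite !inE => /orP[/eqP->|/AT/andP[-> ->]]; rewrite ?eqxx ?teT !orbT //.
  - split=> // Y YT sY.
    have sub : entering A Y \subset entering (e |: A) Y.
      apply/subsetP => f; rewrite !inE => /and3P[-> -> ->]; by rewrite orbT.
    have [YT0|] := eqVneq (Y :&: T) set0; last first.
      move=> /entA/(_ sY); rewrite -!card_gt0 => /leq_trans; apply.
      exact: subset_leq_card.
    (* Here [Y] meets the enlarged [T] only in [h e], so the new edge [e] itself enters [Y]. *)
    have nY x : x \in T -> x \notin Y.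
      by move=> xT; apply/negP => xY; move/setP/(_ x): YT0; rewrite !inE xY xT.
    apply/set0Pn; exists e; rewrite !inE eqxx nY //=.
    case/set0Pn: YT => x; rewrite !inE => /andP[xY /orP[/eqP<-//|/nY]].
    by rewrite xY.
(* [T] cannot have more than [#|V|] elements, so after this many rounds it is everything. *)
have [T [A [_ TT AB _ [entA dBA]]]] := grow #|V|.
exists A => // Y Y0 sY; split; last exact: dBA.
apply: entA => //; move: TT; rewrite ltnNge max_card /= => /eqP ->.
by rewrite setIT.
Qed.

Theorem edmonds k B :
    (forall Y, Y != set0 -> s \notin Y -> k <= #|entering B Y|) ->
  exists A : 'I_k -> {set E},
    (forall i j e, e \in A i -> e \in A j -> i = j) /\
    (forall i Y, Y != set0 -> s \notin Y -> entering (A i) Y != set0).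
Proof.
(* Keeping the classes inside [B] makes those found in [B :\: A0] disjoint from [A0]. *)
suff : (forall Y, Y != set0 -> s \notin Y -> k <= #|entering B Y|) ->
  exists A : 'I_k -> {set E}, (forall i, A i \subset B) /\
    (forall i j e, e \in A i -> e \in A j -> i = j) /\
    (forall i Y, Y != set0 -> s \notin Y -> entering (A i) Y != set0).
  by move=> /[apply] -[A [_ ?]]; exists A.
elim: k B => [B _|k IH B /branching_extract[A0 A0B A0P]].
  by exists (fun=> set0); split; [|split] => -[].
have [|A [AB [Adisj Aent]]] := IH (B :\: A0).
  by move=> Y Y0 sY; have [] := A0P _ Y0 sY.
exists (fun i => if unlift ord0 i is Some j then A j else A0); split; [|split].
- move=> i; case: unliftP => [j _|//]; exact: subset_trans (AB j) (subsetDl _ _).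
- have nA0 j e : e \in A j -> e \notin A0.
    by move=> /(subsetP (AB j)); rewrite inE => /andP[].
  move=> i j e; case: unliftP => [i' ->|->]; case: unliftP => [j' ->|->] //.
  + by move=> ei ej; rewrite (Adisj _ _ _ ei ej).
  + by move=> /nA0/negP.
  + by move=> + /nA0/negP.
- move=> i Y Y0 sY; case: unliftP => [j _|_]; first exact: Aent.
  by have [] := A0P _ Y0 sY.
Qed.

End Branching.

From mathcomp Require Import boolp classical_sets functions cardinality filter.
Require Import Defs.

Local Open Scope classical_set_scope.
Local Open Scope card_scope.

(** * Finite sets and chains *)

Lemma finite_enum T (A : set T) : finite_set A ->
  exists n (f : 'I_n -> T), injective f /\ range f = A.
Proof.
move=> /(@finite_seqP {classic T})[s ->].
have /(tuple_uniqP (in_tuple (undup s))) us := undup_uniq s.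
exists (size (undup s)), (tnth (in_tuple (undup s))); split=> //.
apply/seteqP; split=> [_ [i _ <-]|x]; rewrite /mkset.
  by rewrite -mem_undup; exact: mem_tnth.
by rewrite -mem_undup => /(tnthP (in_tuple _))[i ->]; exists i.
Qed.

Lemma card_leI_inj k T (A : set T) :
  `I_k #<= A <-> exists f : 'I_k -> T, injective f /\ (forall i, A (f i)).
Proof.
rewrite (card_le_eql card_II); split=> [|[f [finj fA]]].
  move=> /card_leP[f]; pose g i : A := f (exist _ i (mem_set I)).
  exists (fun i => val (g i)); split=> [i j /val_inj|i]; last exact/set_mem/valP.
  by move=> gij; have [] := @inj _ _ setT f _ _ (mem_set I) (mem_set I) gij.
rewrite -(card_le_eql (inj_card_eq (in2W finj))); apply: subset_card_le.
by move=> _ [i _ <-].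
Qed.

(** Induction on [n], keeping the larger of two members. In the Zorn argument, a chain of deletions
    can thus exhaust a finite cut only if one member does. *)
Lemma chain_finite_bound T n (f : 'I_n -> T) (C : set (set T)) :
    C !=set0 -> total_on C subset -> (forall i, exists2 X, C X & X (f i)) ->
  exists2 X, C X & forall i, X (f i).
Proof.
move=> [X0 CX0] tot; elim: n f => [|n IH] f fC; first by exists X0 => // -[].
have [X CX Xf] := IH (fun i => f (lift ord0 i)) (fun i => fC _).
have [Y CY Yf] := fC ord0.
have [XY|YX] := tot _ _ CX CY.
  by exists Y => // i; case: (unliftP ord0 i) => [j|] -> //; exact/XY/Xf.
by exists X => // i; case: (unliftP ord0 i) => [j|] -> //; exact/YX/Yf.
Qed.

(** * Rays, ends and finite cuts *)

Section Ends.
Variable G : digraph.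
Implicit Types (S X Y Z : set (vertex G)) (F : set (edge G)).

Definition finite_cut Z := finite_set (edges_between Z (~` Z)).

Definition cut_boundary Z : set (vertex G) :=
  (@tail G) @` edges_between Z (~` Z) `|` (@head G) @` edges_between Z (~` Z).

Lemma cut_boundaryC Z : cut_boundary (~` Z) = cut_boundary Z.
Proof. by rewrite /cut_boundary /edges_between setCK setUC (setUC (diedges Z _)) setUC. Qed.

Lemma finite_cut_boundary Z : finite_cut Z -> finite_set (cut_boundary Z).
Proof. by move=> fZ; rewrite finite_setU; split; exact: finite_image. Qed.

Lemma cut_boundary_joins Z e u v : joins e u v -> Z u -> ~ Z v ->
  cut_boundary Z u.
Proof.
move=> [[<- <-]|[<- <-]] Zu nZv; [left|right]; exists e => //;
  [by left|by right].
Qed.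

Lemma bipartitionC X Y : bipartition X Y -> Y = ~` X.
Proof.
move=> [_ _ XY0 XYT]; apply/seteqP; split=> v.
  by move=> Yv Xv; rewrite -[False]/(set0 v) -XY0.
by move=> nXv; have : setT v by []; rewrite -XYT => -[].
Qed.

(** A path can change sides only at a vertex of the boundary. *)
Lemma connected_off_cut S Z u v :
  cut_boundary Z `<=` S -> connected_off S u v -> Z u -> Z v.
Proof.
move=> ZS [_ _]; elim=> [x y [nSx nSy [e exy]] Zx|//|x y z _ + _ + Zx].
  by apply: contrapT => nZy; exact/nSx/ZS/(cut_boundary_joins exy).
by move=> Zxy Zyz; exact/Zyz/Zxy.
Qed.

Definition eventually_in (x : nat -> vertex G) Z :=
  exists N, forall n, N <= n -> Z (x n).

Lemma ray_avoids (R : ray G) S : finite_set S -> eventually_in (ray_vertex R) (~` S).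
Proof.
move=> fS.
have : finite_set (ray_vertex R @^-1` S).
  by apply: finite_preimage => // i j _ _; exact: ray_vertex_inj.
move=> /finite_seqP[s sE]; exists (\max_(i <- s) i).+1 => n ltn Sn.
have : (ray_vertex R @^-1` S) n by [].
rewrite sE => /= ns; move: ltn; rewrite ltnNge => /negP; apply.
exact: (@leq_bigmax_seq _ s xpredT id).
Qed.

(** A ray visits the finite boundary only finitely often, and past the last visit it cannot cross
    the cut. *)
Lemma ray_side (R : ray G) Z : finite_cut Z ->
  eventually_in (ray_vertex R) Z \/ eventually_in (ray_vertex R) (~` Z).
Proof.
move=> /finite_cut_boundary/(ray_avoids R)[N avoid].
have step W : cut_boundary W = cut_boundary Z -> W (ray_vertex R N) ->
    eventually_in (ray_vertex R) W.
  move=> WZ WN; exists N => n; elim: n => [|n IH].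
    by rewrite leqn0 => /eqP <-.
  rewrite leq_eqVlt ltnS => /orP[/eqP <-//|Nn].
  apply: contrapT => nW; apply: (avoid n Nn); rewrite -WZ.
  exact: cut_boundary_joins (ray_joins R n) (IH Nn) nW.
have [ZN|nZN] := pselect (Z (ray_vertex R N)); [left|right]; apply: step => //.
exact: cut_boundaryC.
Qed.

Lemma finite_cut_separates (R : ray G) Z D Y : finite_cut Z -> finite_set D ->
    eventually_in (ray_vertex R) (~` Z) -> Y `<=` D `|` Z ->
  finitely_separable (range (ray_vertex R)) Y.
Proof.
move=> fZ fD [N RZ] YDZ.
(* The boundary blocks the tail of [R] from [Z]; the initial segment of [R] and the part of [Y]
   outside [Z] are deleted outright. *)
exists (cut_boundary Z `|` D `|` ray_vertex R @` `I_N).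
  rewrite 2!finite_setU; split; last exact: finite_image.
  by split=> //; exact: finite_cut_boundary.
move=> _ y [n _ <-] Yy c.
have [nSn nSy _] := c.
have Nn : N <= n by rewrite leqNgt; apply/negP => nN; apply: nSn; right; exists n.
have Zy : Z y.
  by have [Dy|//] := YDZ y Yy; case: nSy; left; right.
suff : (~` Z) y by exact.
apply: connected_off_cut c (RZ _ Nn).
by rewrite cut_boundaryC => v; left; left.
Qed.

Lemma eventually_in_inseparable (R : ray G) Z :
  eventually_in (ray_vertex R) Z -> ~ finitely_separable (range (ray_vertex R)) Z.
Proof.
move=> [N RZ] [S fS sep]; have [M RS] := ray_avoids R fS.
pose n := maxn N M; have Zn := RZ n (leq_maxl _ _); have Sn := RS n (leq_maxr _ _).
apply: (sep (ray_vertex R n) (ray_vertex R n)) => //.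
by split=> //; exact: Relation_Operators.rt_refl.
Qed.

(* Treats vertex and end roots uniformly: [x] is constant or traverses a ray of [r]. *)
Lemma root_sequence (r : vertex G + graph_end G) :
  exists x : nat -> vertex G,
    forall Z, finite_cut Z -> comb_closure Z r <-> eventually_in x Z.
Proof.
case: r => [v|[w [R0 wE]]].
  by exists (fun=> v) => Z _; split=> [Zv|[N /(_ N)]]; [exists 0|exact].
exists (ray_vertex R0) => Z fZ; rewrite /comb_closure /= wE.
split=> [[R eqR nsep]|R0Z].
  have [//|R0Z] := ray_side R0 fZ.
  have [[N RZ]|RZ] := ray_side R fZ; last first.
    by case: nsep; apply: finite_cut_separates fZ (finite_set0 _) RZ _ => v; right.
  (* [R] lies in [Z] up to a finite initial segment while [R0] ends up outside, so the cut separates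
     two equivalent rays. *)
  case: eqR.
  apply: finite_cut_separates fZ (finite_image (ray_vertex R) (finite_II N)) R0Z _.
  move=> _ [n _ <-]; have [Nn|nN] := leqP N n; [right; exact: RZ|left; by exists n].
exists R0; last exact: eventually_in_inseparable.
by apply: eventually_in_inseparable; exists 0 => n _; exists n.
Qed.

(** * Rooted cuts, minimal reachable sets and packings *)

Definition rooted_cut (r : vertex G + graph_end G) Z :=
  [/\ bipartition Z (~` Z), finite_cut Z & comb_closure Z r].

Lemma spanning_reachableP (r : vertex G + graph_end G) F :
  spanning_reachable r F <->
  forall Z, rooted_cut r Z -> F `&` diedges Z (~` Z) !=set0.
Proof.
split=> [sF Z [bZ fZ rZ]|sF X Y bXY fXY rX _]; last first.
  have YE := bipartitionC bXY; rewrite YE in bXY fXY *; exact: sF.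
(* A vertex outside [Z] differs from a vertex root, which lies in [Z]. *)
apply: sF => //; case: bZ => _ [v nZv] _ _; exists v; split=> // vr.
by move: rZ; rewrite -vr.
Qed.

(** Zorn's lemma is applied to the deleted sets [D], so that minimality becomes maximality and
    chains are bounded by their unions. *)
Lemma pseudo_arborescence_sub (r : vertex G + graph_end G) F :
  spanning_reachable r F ->
  exists2 A, A `<=` F & spanning_pseudo_arborescence r A.
Proof.
move=> sF.
have [C CC|D [sD maxD]] :=
    @Zorn_bigcup _ [set D | spanning_reachable r (F `\` D)].
  move=> tot; apply/spanning_reachableP => Z rZ.
  have [[D CD]|C0] := pselect (C !=set0); last first.
    move/spanning_reachableP/(_ _ rZ): sF => [e [Fe Ze]].
    by exists e; split=> //; split=> // -[X CX]; case: C0; exists X.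
  apply: contrapT => noe.
  have fin : finite_set (F `&` diedges Z (~` Z)).
    have [_ + _] := rZ; apply: sub_finite_set => e [_ Ze]; by left.
  have [n [f [_ fE]]] := finite_enum fin.
  have [||X CX Xf] := @chain_finite_bound _ _ f C _ tot.
    - by exists D.
    - move=> i; have [Fi Zi] : (F `&` diedges Z (~` Z)) (f i) by rewrite -fE; exists i.
      by apply: contrapT => nX; apply: noe; exists (f i).
  have /spanning_reachableP/(_ _ rZ)[e [[Fe nXe] Ze]] := CC _ CX.
  have : (F `&` diedges Z (~` Z)) e by [].
  by rewrite -fE => -[i _ ie]; apply: nXe; rewrite -ie.
exists (F `\` D); first by move=> e [].
split=> // F' F'sub sF'; apply: contrapT => neq.
(* A reachable [F'] properly inside the remainder would have a complement that is a larger deletable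
   set. *)
apply: (maxD (~` F')); last first.
  rewrite /= setDE setCK; suff -> : F `&` F' = F' by [].
  by apply/setIidr => e /F'sub[].
split=> [e De F'e|sub]; first by have [_] := F'sub _ F'e.
apply/neq/seteqP; split=> // e [Fe nDe]; apply: contrapT => nF'e.
by apply: nDe; exact: sub.
Qed.

(* The vertices of the finite multigraph are the nonempty atoms of the algebra
   generated by the [X j], encoded by their membership vectors. *)
Lemma finite_family_reachable (r : vertex G + graph_end G) k n
    (X : 'I_n -> set (vertex G)) :
    (forall Z, rooted_cut r Z -> `I_k #<= diedges Z (~` Z)) ->
    (forall j, rooted_cut r (X j)) ->
  exists A : 'I_k -> set (edge G), trivIset setT A /\
    forall i j, A i `&` diedges (X j) (~` X j) !=set0.
Proof.
move=> dk rX; have [x xE] := root_sequence r.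
pose atom v : {ffun 'I_n -> bool} := [ffun j => `[< X j v >]].
pose W := {a | `[< exists v, atom v = a >]}.
have atomP v : `[< exists u, atom u = atom v >] by apply/asboolP; exists v.
pose at_ v : W := Sub (atom v) (atomP v).
have at_surj a : exists v, at_ v = a.
  by have /asboolP[v va] := valP a; exists v; exact: val_inj.
have at_eq u v : (forall j, X j u <-> X j v) -> at_ u = at_ v.
  move=> uv; apply: val_inj; apply/ffunP => j; rewrite !ffunE.
  by apply/asboolP/asboolP => /uv.
(* A common tail of the root sequence lies in all [X j], hence in a single atom, the root [s] of the
   quotient. *)
have [N xN] : exists N, forall m, N <= m -> forall j, X j (x m).
  have /choice[b bP] : forall j, exists N, forall m, N <= m -> X j (x m).
    by move=> j; have [_ fj rj] := rX j; exact/xE.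
  exists (\max_j b j) => m bm j; apply: bP; apply: leq_trans bm.
  exact: leq_bigmax.
pose s := at_ (x N).
have xs m : N <= m -> at_ (x m) = s.
  by move=> Nm; apply: at_eq => j; split=> _; exact: xN.
(* Only edges crossing some [X j] survive the contraction; all others lie inside an atom. *)
have fB : finite_set (\bigcup_j edges_between (X j) (~` X j)).
  by apply: bigcup_finite => // j _; have [] := rX j.
have [m [f [finj fE]]] := finite_enum fB.
have crossing e : at_ (tail e) <> at_ (head e) -> exists i, f i = e.
  move=> the; suff : range f e by case=> i _ <-; exists i.
  rewrite fE; apply: contrapT => ne; apply: the; apply: at_eq => j.
  split=> Xj; apply: contrapT => nXj; apply: ne; exists j => //; [by left|by right].
pose t i := at_ (tail (f i)); pose h i := at_ (head (f i)).
have deg (Y : {set W}) : Y != finset.set0 -> s \notin Y ->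
    k <= #|entering t h [set: 'I_m]%SET Y|.
  (* The union of the atoms outside [Y] is again a rooted cut of [G], so [dk] bounds the degree of
     [Y]. *)
  move=> /finset.set0Pn[a aY] sY; pose Z := [set v | at_ v \notin Y].
  have ZC v : (~` Z) v <-> at_ v \in Y by rewrite /Z /=; split=> [/negP/negPn|->].
  have rZ : rooted_cut r Z.
    have fZ : finite_cut Z.
      have : finite_set (range f) by rewrite fE.
      apply: sub_finite_set => e Ze.
      suff /crossing[i <-] : at_ (tail e) <> at_ (head e) by exists i.
      case: Ze => -[tZ hZ] E.
        by apply: hZ; rewrite /Z /= -E.
      by apply: tZ; rewrite /Z /= E.
    split=> //.
    - split.
      + by exists (x N).
      + by have [v va] := at_surj a; exists v; apply/ZC; rewrite va.
      + exact: setICr.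
      + exact: setUCr.
    - by apply/xE => //; exists N => l Nl; rewrite /Z /= xs.
  have /card_leI_inj[g [ginj gZ]] := dk _ rZ.
  have /choice[g' g'E] : forall i, exists i', f i' = g i.
    move=> i; apply: crossing; have [+ /ZC] := gZ i; rewrite /Z /=.
    by move=> /[swap] hY /[swap] ->; rewrite hY.
  have g'inj : injective g' by move=> i j ij; apply: ginj; rewrite -!g'E ij.
  rewrite -{1}(card_ord k) -(card_codom g'inj); apply: subset_leq_card.
  apply/fintype.subsetP => _ /codomP[i ->]; rewrite !inE /t /h g'E.
  by have [+ /ZC ->] := gZ i; rewrite andbT.
have [c [cdisj cent]] := edmonds deg.
exists (fun i => f @` [set` c i]); split.
  move=> i j _ _ [_ [[e /= ei <-] [e' /= e'j]]] /finj e'e.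
  by apply: (cdisj i j e) => //; rewrite -e'e.
move=> i j; pose Y := [set a : W | ~~ val a j]%SET.
have YE v : (at_ v \in Y) = ~~ `[< X j v >] by rewrite inE ffunE.
have [[_ [v nXv] _ _] _ _] := rX j.
have /finset.set0Pn[e] : entering t h (c i) Y != finset.set0.
  apply: cent; first by apply/finset.set0Pn; exists (at_ v); rewrite YE; apply/asboolPn.
  by rewrite YE negbK; apply/asboolP; exact: xN.
rewrite inE !YE negbK => /and3P[ei /asboolP te /asboolPn he].
by exists (f e); split=> //; exists e.
Qed.

Lemma reachable_packing (r : vertex G + graph_end G) k :
    (forall Z, rooted_cut r Z -> `I_k #<= diedges Z (~` Z)) ->
  exists A : 'I_k -> set (edge G), trivIset setT A /\
    forall i, spanning_reachable r (A i).
Proof.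
move=> dk.
pose good P (A : 'I_k -> set (edge G)) := trivIset setT A /\
  forall i Z, P Z -> A i `&` diedges Z (~` Z) !=set0.
pose fam P := finite_set P /\ P `<=` rooted_cut r.
have /choice[A AP] : forall P : set (set (vertex G)), exists A, fam P -> good P A.
  (* Families outside [fam] get empty classes as a default. *)
  move=> P; have [[fP rP]|nP] := pselect (fam P); last by exists (fun=> set0).
  have [n [X [_ XE]]] := finite_enum fP.
  have [||A [Adisj AX]] := @finite_family_reachable r k n X.
  - exact: dk.
  - by move=> j; apply: rP; rewrite -XE; exists j.
  - by exists A => _; split=> // i Z; rewrite -XE => -[j _ <-].
(* An ultrafilter above this filter contains, for each rooted cut, the set of finite families
   including it. *)
pose cofinal : set_system (set (set (vertex G))) :=
  [set Q | exists2 P0, fam P0 & forall P, fam P -> P0 `<=` P -> Q P].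
have : ProperFilter cofinal.
  split; first by move=> [P0 fP0 /(_ _ fP0)]; exact.
  split.
  - by exists set0 => //; split.
  - move=> Q Q' [P [fP rP] QP] [P' [fP' rP'] QP'].
    exists (P `|` P') => [|P1 fP1 sub].
      by split; [rewrite finite_setU|move=> Z [/rP|/rP']].
    by split; [apply: QP|apply: QP'] => // Z PZ; apply: sub; [left|right].
  - by move=> Q Q' QQ' [P fP QP]; exists P => // P1 fP1 /(QP _ fP1)/QQ'.
move=> /ultraFilterLemma[U [Uultra cofU]].
exists (fun i => [set e | U [set P | A P i e]]); split.
  have Ufam : U fam by apply: cofU; exists set0 => //; split.
  move=> i j _ _ [e [Ui Uj]].
  have [P [[Pi Pj] fP]] := filter_ex (filterI (filterI Ui Uj) Ufam).
  by have [disj _] := AP _ fP; apply: disj => //; exists e.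
(* If all of the finitely many edges of the cut were missing from the limit class, then some finite
   family containing [Z] would have a class missing all of them. *)
move=> i; apply/spanning_reachableP => Z rZ; apply: contrapT => noe.
have [_ fZ _] := rZ.
have fD : finite_set (diedges Z (~` Z)).
  by apply: sub_finite_set fZ => e; left.
have [n [f [_ fE]]] := finite_enum fD.
have UC : U (\bigcap_(j in [set: 'I_n]) ~` [set P | A P i (f j)]).
  suff : \forall P \near U, forall j, ~ A P i (f j).
    by apply: filterS => P nA j _; exact: nA.
  apply: filter_forall => j.
  have [Uj|//] := in_ultra_setVsetC [set P | A P i (f j)] Uultra.
  by case: noe; exists (f j); split=> //; rewrite -fE; exists j.
have UZ : U [set P | fam P /\ P Z].
  apply: cofU; exists [set Z]; first by split=> // _ ->.
  by move=> P fP; rewrite sub1set inE.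
have [P [nA [fP PZ]]] := filter_ex (filterI UC UZ).
have [_ /(_ i _ PZ)[e [Ae]]] := AP _ fP.
by rewrite -fE => -[j _ je]; apply: (nA j) => //=; rewrite je.
Qed.

End Ends.

Theorem theorem4p3 (G : digraph) (r : vertex G + graph_end G) (k : nat)
    (Glf : locally_finite G) (Gwc : weakly_connected G) :
  (exists A : 'I_k -> set (edge G),
      (forall i, spanning_pseudo_arborescence r (A i)) /\ trivIset setT A)
  <->
  (forall X Y : set (vertex G),
      bipartition X Y -> comb_closure X r -> finite_set (edges_between X Y) ->
      `I_k #<= in_edges Y).
Proof.
split=> [[A [spA disj]] X Y bXY rX fXY|dk].
  have YE := bipartitionC bXY; rewrite YE /in_edges setCK in bXY fXY *.
  (* One edge of the cut is picked from each class; disjointness makes the choice injective. *)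
  have /choice[f fA] i : exists e, (A i `&` diedges X (~` X)) e.
    by have [/spanning_reachableP sA _] := spA i; apply: sA; split.
  apply/card_leI_inj; exists f; split=> [i j fij|i]; last by have [] := fA i.
  apply: disj => //; exists (f i); split; first by have [] := fA i.
  by rewrite fij; have [] := fA j.
have [|A [disj sA]] := @reachable_packing G r k.
  by move=> Z [bZ fZ rZ]; have := dk _ _ bZ rZ fZ; rewrite /in_edges setCK.
(* Shrinking the classes to minimal ones preserves disjointness. *)
have /choice[B BP] i : exists B, B `<=` A i /\ spanning_pseudo_arborescence r B.
  by have [B BA spB] := pseudo_arborescence_sub (sA i); exists B.
exists B; split=> [i|i j _ _ [e [Bi Bj]]]; first by have [] := BP i.
by apply: disj => //; exists e; split; [exact: (BP i).1|exact: (BP j).1].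
Qed.
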